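(* Let $H\neq\{0\}$ be a complex Hilbert space and let $B$ be an invertible bounded linear operator on $H$. There exist $\lambda_B\in\mathbb{C}$ and $\lambda_{B^{-1}}\in\mathbb{C}$ at which the infima $$\inf_{\lambda\in\mathbb{C}}\|I-\lambda B\|\qquad\text{and}\qquad\inf_{\lambda\in\mathbb{C}}\|I-\lambda B^{-1}\|,$$ respectively, are attained. Any such $\lambda_B$ and $\lambda_{B^{-1}}$ fulfill $$\lambda_B\in\overline{\operatorname{Num}}(B^{-1}),\qquad \|\lambda_B B\|\le 1+M_B,$$ $$\lambda_{B^{-1}}\in\overline{\operatorname{Num}}(B),\qquad \|\lambda_{B^{-1}}B^{-1}\|\le 1+M_B,$$ where $$M_B=\sup_{z\in H}\ \sup_{k\in\mathbb{N}}\ \frac{\|r_k^{B,z}\|}{\|r_{k-1}^{B,z}\|}$$ is the linear reduction factor of $B$.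
   Context: $(\cdot,\cdot)$ is the inner product of $H$ (linear in the first argument); $\|\cdot\|$ denotes both the norm of $H$ and the induced operator norm; $I$ is the identity; $\mathbb{N}=\{1,2,\dots\}$; invertible means having a bounded inverse on $H$. For a bounded linear operator $T$ on $H$, the numerical range is $\operatorname{Num}(T)=\{(Tz,z): z\in H,\ \|z\|=1\}\subset\mathbb{C}$, and $\overline{\operatorname{Num}}(T)$ is its closure in $\mathbb{C}$. $\mathcal{P}_k$ is the space of complex polynomials of degree at most $k$. GMRES residuals: for a bounded linear operator $T$ on $H$, an initial residual $r_0\in H$ and $k=0,1,2,\dots$, let $\mathcal{K}_k(T,r_0)=\operatorname{span}\{r_0,Tr_0,\dots,T^{k-1}r_0\}$ (so $\mathcal{K}_0=\{0\}$). The $k$-th GMRES residual $r_k^{T,r_0}$ is the element of minimal norm in the affine space $r_0+T\mathcal{K}_k(T,r_0)$. Thus $r_0^{T,r_0}=r_0$ and $\|r_k^{T,r_0}\|=\min_{p\in\mathcal{P}_k,\,p(0)=1}\|p(T)r_0\|$. The number $M_B$ is equivalently the best (smallest nonnegative) constant $M$ such that $\|r_k^{B,z}\|\le M\,\|r_{k-1}^{B,z}\|$ for all $k\in\mathbb{N}$ and all $z\in H$; accordingly, quotients $0/0$ of norms of residuals are interpreted as $0$. *)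

(* Defs.v *)
From HB Require Import structures.
From mathcomp Require Import all_boot all_order all_algebra.
From mathcomp Require Export complex.
From mathcomp Require Import all_classical all_reals all_analysis.

Set Implicit Arguments.
Unset Strict Implicit.
Unset Printing Implicit Defensive.

Import Order.TTheory GRing.Theory Num.Theory.
Import numFieldNormedType.Exports.

Local Open Scope classical_set_scope.
Local Open Scope ring_scope.
Local Open Scope complex_scope.

Section Operators.
Context {R : realType} {H : completeNormedModType R[i]}.
Implicit Types (T : H -> H) (x : H) (k : nat).

(* The norm of a normed module over R[i] takes its values in R[i] (on the
   nonnegative real axis); [rnorm] is the same number, read in R. *)
Definition rnorm x : R := complex.Re `|x|.

Definition bounded_operator T : Prop :=
  exists M : R, forall x, rnorm (T x) <= M * rnorm x.

Definition bounded_inverse (B Binv : H -> H) : Prop :=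
  [/\ cancel B Binv, cancel Binv B & bounded_operator Binv].

(* Meaningful for bounded T: the real [sup] of an unbounded set is 0. *)
Definition opnorm T : R := sup [set rnorm (T x) | x in [set x | rnorm x <= 1]].

(* The numerical range; the type R[i]^o carries the usual topology of the
   complex plane, in which the closure is taken. *)
Definition num_range (dot : H -> H -> R[i]) T : set R[i]^o :=
  [set dot (T z) z | z in [set z | rnorm z = 1]].

Definition krylov T (r0 : H) k : set H :=
  [set \sum_(i < k) c i *: iter i T r0 | c in [set: 'I_k -> R[i]]].

Definition residual_space T (r0 : H) k : set H :=
  [set r0 + T x | x in krylov T r0 k].

(* The element of minimal norm of the (finite-dimensional) affine space
   [residual_space T r0 k], which exists and is unique when T is linear and
   the norm of H comes from an inner product. The default value 0 of [xget]
   is then never used. *)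
Definition gmres_residual T (r0 : H) k : H :=
  xget 0 [set y | residual_space T r0 k y /\
                  forall w, residual_space T r0 k w -> rnorm y <= rnorm w].

(* The index k ranges over 0, 1, 2, ... and stands for k.+1 >= 1. The
   quotients 0 / 0 are 0 by the convention of the library, and all quotients
   lie in [0, 1] since the residual spaces increase with k, so that both
   suprema are those of nonempty bounded sets. *)
Definition reduction_factor T : R :=
  sup (range (fun z : H =>
    sup (range (fun k : nat =>
      rnorm (gmres_residual T z k.+1) / rnorm (gmres_residual T z k))))).

Definition attains_inf (f : R[i] -> R) (l : R[i]) : Prop :=
  f l = inf (range f).

End Operators.

(* Main.v *)
Require Import Defs.
From HB Require Import structures.
From mathcomp Require Import all_boot all_order all_algebra.
From mathcomp Require Import all_classical all_reals all_analysis.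
From mathcomp Require Import ring lra.

Import Order.TTheory GRing.Theory Num.Theory.
Import numFieldNormedType.Exports.

(** Let N be the minimum of |I - l B| over l, attained at l; write A = I - l B
    and f(z) = (Az, Bz). The proof rests on the fact that optimality of l is
    visible on single vectors ([near_extremal_vector]): for every e > 0 there
    is a unit vector z with

      |Az|^2 >= N^2 - e   and   |f(z)| <= e.

    The second condition says that Az is almost orthogonal to Bz, so l is
    almost the best scalar for the vector z alone: by Pythagoras no m brings
    |z - m Bz|^2 below N^2 - O(e). It also says, with w = Bz, that l is
    within O(e) of (B^-1 w, w) / (w, w), a point of the numerical range of
    B^-1 ([extremal_vector]). Letting e tend to 0, l lies in the closure of
    Num(B^-1). Moreover the minimum over m of |z - m Bz| is the norm of the
    first GMRES residual, so N <= M_B, and |l B| <= |I| + |I - l B| = 1 + N.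

    For the inverse, the best ratio |z - m B^-1 z| / |z| is the sine of the
    angle between z and B^-1 z; it is also the best ratio |w - m Bw| / |w| for
    w = B^-1 z ([line_distance_sym]). So the same argument, applied to B^-1,
    again ends at M_B.

    The near-extremal vectors come from a descent in the spirit of the
    Toeplitz-Hausdorff theorem ([descent]). Minimality of l means that moving
    l in the direction th cannot decrease |A|; this yields, for each th of
    modulus 1, almost maximizing vectors w of |Aw| with Re (th^* f(w)) as
    small as desired. Given an almost maximizing z with |f(z)| >= e, take such
    a w for th = f(z) / |f(z)| and move from z a short way towards w, after
    turning w by a phase which makes the first order change of f point against
    th. The modulus of f drops by a fixed amount, while the defect
    N^2 |x|^2 - |Ax|^2, being a nonnegative quadratic form, grows at most by a
    fixed factor. As f is bounded, a number of steps which depends only on e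
    brings |f| below e, and a tiny initial defect remains small
    ([small_form_value]).

    The minimum over l is attained because l |-> |I - l B| is Lipschitz and,
    outside a large square, is at least its value at 0. *)

Set Implicit Arguments.
Unset Strict Implicit.
Unset Printing Implicit Defensive.

Local Open Scope classical_set_scope.
Local Open Scope complex_scope.
Local Open Scope ring_scope.

(** * The modulus of a complex number, as a real number *)

Section Modulus.
Variable R : realType.
Implicit Types a b c : R[i].

Definition cmod c : R := Normc.normc c.

Lemma sqr_cmod c : cmod c ^+ 2 = complex.Re c ^+ 2 + complex.Im c ^+ 2.
Proof. by case: c => x y; rewrite sqr_sqrtr // addr_ge0 ?sqr_ge0. Qed.

Lemma cmod_ge0 c : 0 <= cmod c.
Proof. by case: c => x y; exact: sqrtr_ge0. Qed.

Lemma cmodM a b : cmod (a * b) = cmod a * cmod b.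
Proof. exact: Normc.normcM. Qed.

Lemma cmodD a b : cmod (a + b) <= cmod a + cmod b.
Proof. exact: le_normcD. Qed.

Lemma cmodN a : cmod (- a) = cmod a.
Proof. exact: normcN. Qed.

Lemma cmodJ a : cmod a^* = cmod a.
Proof. by case: a => x y; rewrite /cmod /= sqrrN. Qed.

Lemma cmodR (x : R) : 0 <= x -> cmod x%:C = x.
Proof. by move=> x0; rewrite /cmod /= expr0n addr0 sqrtr_sqr ger0_norm. Qed.

Lemma norm_cmod c : `|c| = (cmod c)%:C.
Proof. by []. Qed.

Lemma normRe_cmod c : `|complex.Re c| <= cmod c.
Proof.
by rewrite -(ler_pXn2r (n := 2)) ?nnegrE ?cmod_ge0 // real_normK ?num_real //
  sqr_cmod lerDl sqr_ge0.
Qed.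

Lemma normIm_cmod c : `|complex.Im c| <= cmod c.
Proof.
by rewrite -(ler_pXn2r (n := 2)) ?nnegrE ?cmod_ge0 // real_normK ?num_real //
  sqr_cmod lerDr sqr_ge0.
Qed.

Lemma conjcZ (x : R) a : (x%:C * a)^* = x%:C * a^*.
Proof. by case: a => y z; simpc; congr (_ +i* _); ring. Qed.

Lemma mulcJ a : a * a^* = (cmod a ^+ 2)%:C.
Proof. by rewrite sqr_cmod; case: a => x y; simpc; congr (_ +i* _); ring. Qed.

Lemma cmod_eq0 a : (cmod a == 0) = (a == 0).
Proof.
apply/eqP/eqP => [/Normc.eq0_normc //|->]; exact: Normc.normc0.
Qed.

Lemma phase_exists a : exists2 u : R[i], cmod u = 1 & u * a = (cmod a)%:C.
Proof.
have [->|a0] := eqVneq a 0.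
  by exists 1; rewrite ?mul1r /cmod ?Normc.normc0 // Normc.normc1.
have m0 : cmod a != 0 by rewrite cmod_eq0.
exists (((cmod a)^-1)%:C * a^*).
  by rewrite cmodM cmodJ cmodR ?invr_ge0 ?cmod_ge0 // mulVf.
by rewrite -mulrA [_^* * _]mulrC mulcJ -rmorphM /=; congr (_%:C); field.
Qed.

(** The imaginary part of [u^* a + u b] is that of u times [b - a^*], so
    it vanishes for the phase of the conjugate of [b - a^*]; replacing [u] by
    [- u] then fixes the sign. *)
Lemma real_nonpos_phase a b : exists u : R[i], exists2 x : R,
  cmod u = 1 & (0 <= x <= cmod a + cmod b) /\ u^* * a + u * b = (- x)%:C.
Proof.
have [u u1 uE] := phase_exists (b - a^*).
have im0 : complex.Im (u^* * a + u * b) = 0.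
  transitivity (complex.Im (u * (b - a^*))); last by rewrite uE.
  by case: (u) (a) (b) => [? ?] [? ?] [? ?] /=; ring.
have ub : cmod (u^* * a + u * b) <= cmod a + cmod b.
  by rewrite (le_trans (cmodD _ _)) // !cmodM cmodJ u1 !mul1r.
have E : u^* * a + u * b = (complex.Re (u^* * a + u * b))%:C.
  by rewrite [LHS]complexE im0 mulr0 addr0.
have ub' := le_trans (normRe_cmod _) ub.
have [x0|x0] := leP (complex.Re (u^* * a + u * b)) 0.
  exists u, (- complex.Re (u^* * a + u * b)) => //; split; last by rewrite opprK.
  by rewrite oppr_ge0 x0 /= -(ler0_norm x0).
exists (- u), (complex.Re (u^* * a + u * b)); first by rewrite cmodN.
split; last by rewrite !rmorphN /= -E; ring.
by rewrite ltW //= (le_trans (ler_norm _)).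
Qed.

End Modulus.

(** * Real-valued norms and inner products *)

Section InnerProduct.
Context {R : realType} {H : completeNormedModType R[i]}.
Implicit Types (x y z : H) (c : R[i]).

Lemma normE x : `|x| = (rnorm x)%:C.
Proof. by rewrite /rnorm RRe_real // normr_real. Qed.

Lemma rnorm_ge0 x : 0 <= rnorm x.
Proof. by rewrite -ler0c -normE. Qed.

Lemma rnormZ c x : rnorm (c *: x) = cmod c * rnorm x.
Proof.
apply: (@complexI R); rewrite -normE normrZ norm_cmod normE.
by rewrite -rmorphM.
Qed.

Lemma rnormD x y : rnorm (x + y) <= rnorm x + rnorm y.
Proof. by rewrite -lecR rmorphD /= -!normE ler_normD. Qed.

Lemma rnormN x : rnorm (- x) = rnorm x.
Proof. by rewrite /rnorm normrN. Qed.

Lemma rnorm0 : rnorm (0 : H) = 0.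
Proof. by rewrite /rnorm normr0. Qed.

Lemma rnorm_eq0 x : (rnorm x == 0) = (x == 0).
Proof. by rewrite -(inj_eq (@complexI R)) -normE normr_eq0. Qed.

Lemma rnorm_gt0 x : (0 < rnorm x) = (x != 0).
Proof. by rewrite lt_neqAle rnorm_ge0 andbT eq_sym rnorm_eq0. Qed.

Lemma normalize x : x != 0 -> rnorm (((rnorm x)^-1)%:C *: x) = 1.
Proof.
move=> x0; rewrite rnormZ cmodR ?invr_ge0 ?rnorm_ge0 // mulVf //.
by rewrite rnorm_eq0.
Qed.

(** The four identities are bundled in a proposition because they are used
    for forms built from the inner product inside proofs. *)
Definition is_sesqui (f : H -> H -> R[i]) :=
  [/\ forall x y z, f (x + y) z = f x z + f y z,
      forall x y z, f z (x + y) = f z x + f z y,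
      forall c x z, f (c *: x) z = c * f x z
    & forall c x z, f z (c *: x) = c^* * f z x].

Lemma sesqui_diagD f x y : is_sesqui f ->
  f (x + y) (x + y) = f x x + (f x y + f y x) + f y y.
Proof. by case=> fDl fDr _ _; rewrite fDl !fDr; ring. Qed.

Lemma sesqui_diagZ f c x : is_sesqui f ->
  f (c *: x) (c *: x) = (cmod c ^+ 2)%:C * f x x.
Proof. by case=> _ _ fZl fZr; rewrite fZl fZr mulrA mulcJ. Qed.

Lemma sesqui_diag_line f c x y : is_sesqui f ->
  f (x + c *: y) (x + c *: y) =
  f x x + (c^* * f x y + c * f y x) + (cmod c ^+ 2)%:C * f y y.
Proof.
move=> sf; rewrite sesqui_diagD // sesqui_diagZ //.
by case: sf => _ _ -> ->.
Qed.

Variable dot : {dot H for Num.conj}.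
Hypothesis norm_dot : forall x : H, `|x| = sqrtC (dot x x).

Lemma sesqui_dot : is_sesqui dot.
Proof.
split=> *; [exact: linearDl|exact: linearDr|exact: linearZl_LR|].
exact: linearZr_LR.
Qed.

Lemma dotC x y : dot x y = (dot y x)^*.
Proof. by rewrite hermC expr0 mul1r. Qed.

Lemma dot_diag x : dot x x = (rnorm x ^+ 2)%:C.
Proof. rewrite rmorphXn /= -normE norm_dot sqrtCK; reflexivity. Qed.

Lemma sqr_rnorm x : rnorm x ^+ 2 = complex.Re (dot x x).
Proof. by rewrite dot_diag. Qed.

Lemma dotBl x y z : dot (x - y) z = dot x z - dot y z.
Proof. by rewrite linearBl. Qed.

Lemma sqr_rnormD x y :
  rnorm (x + y) ^+ 2 = rnorm x ^+ 2 + 2 * complex.Re (dot x y) + rnorm y ^+ 2.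
Proof.
rewrite !sqr_rnorm (sesqui_diagD x y sesqui_dot) [dot y x]dotC.
by case: (dot x x) (dot x y) (dot y y) => [? ?] [? ?] [? ?] /=; ring.
Qed.

Lemma sqr_rnormZ c x : rnorm (c *: x) ^+ 2 = cmod c ^+ 2 * rnorm x ^+ 2.
Proof. by rewrite rnormZ exprMn. Qed.

Lemma parallelogram x y :
  rnorm (x + y) ^+ 2 + rnorm (x - y) ^+ 2 = 2 * rnorm x ^+ 2 + 2 * rnorm y ^+ 2.
Proof.
rewrite !sqr_rnormD rnormN; have -> : dot x (- y) = - dot x y.
  exact: linearNr.
by rewrite raddfN /=; ring.
Qed.

(** Pythagoras for the projection on the line of [y], multiplied by the
    squared norm of [y] so that it has no denominator: the first difference on
    the right is the Gram determinant of [x] and [y], which is symmetric. *)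
Lemma sqr_dist_line x y c :
  rnorm (x - c *: y) ^+ 2 * rnorm y ^+ 2 =
  rnorm x ^+ 2 * rnorm y ^+ 2 - cmod (dot x y) ^+ 2
  + cmod (dot x y - c * (rnorm y ^+ 2)%:C) ^+ 2.
Proof.
rewrite sqr_rnormD rnormN sqr_rnormZ.
have -> : dot x (- (c *: y)) = - (c^* * dot x y).
  by case: sesqui_dot => _ _ _ <-; exact: linearNr.
rewrite !sqr_cmod; move: (dot x y) (rnorm x ^+ 2) (rnorm y ^+ 2).
by case: c => c1 c2 [d1 d2] X Y /=; ring.
Qed.

Definition line_coef x y : R[i] := dot x y * ((rnorm y ^+ 2)^-1)%:C.

Lemma sqr_dist_line_min x y : y != 0 ->
  rnorm (x - line_coef x y *: y) ^+ 2 * rnorm y ^+ 2 =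
  rnorm x ^+ 2 * rnorm y ^+ 2 - cmod (dot x y) ^+ 2.
Proof.
move=> y0; rewrite sqr_dist_line.
have -> : line_coef x y * (rnorm y ^+ 2)%:C = dot x y.
  rewrite -mulrA -(rmorphM (real_complex R)) mulVf ?expf_neq0 ?rnorm_eq0 //.
  by rewrite rmorph1 mulr1.
by rewrite subrr [in X in _ + X]/cmod Normc.normc0 expr0n addr0.
Qed.

Lemma cmod_dot_le x y : cmod (dot x y) <= rnorm x * rnorm y.
Proof.
have [->|y0] := eqVneq y 0.
  have -> : dot x 0 = 0 by exact: linear0r.
  by rewrite rnorm0 mulr0 /cmod Normc.normc0.
rewrite -(ler_pXn2r (n := 2)) ?nnegrE ?cmod_ge0 ?mulr_ge0 ?rnorm_ge0 //.
by rewrite exprMn -subr_ge0 -sqr_dist_line_min // mulr_ge0 ?sqr_ge0.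
Qed.

Lemma line_distance_attained x y : exists c, forall m,
  rnorm (x - c *: y) <= rnorm (x - m *: y).
Proof.
have [->|y0] := eqVneq y 0.
  by exists 0 => m; rewrite !scaler0.
have Y0 : 0 < rnorm y ^+ 2 by rewrite exprn_gt0 ?rnorm_gt0.
exists (line_coef x y) => m.
rewrite -(ler_pXn2r (n := 2)) ?nnegrE ?rnorm_ge0 // -(ler_pM2r Y0).
by rewrite sqr_dist_line_min // sqr_dist_line lerDl sqr_ge0.
Qed.

(** Relative to |x|, resp. |y|, the distance of [x] to the line of [y] and
    that of [y] to the line of [x] are both the sine of the angle between [x]
    and [y], since the Gram determinant is symmetric. *)
Lemma line_distance_sym x y (t : R) : x != 0 -> y != 0 ->
  (forall m, t * rnorm x ^+ 2 <= rnorm (x - m *: y) ^+ 2) ->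
  forall m, t * rnorm y ^+ 2 <= rnorm (y - m *: x) ^+ 2.
Proof.
move=> x0 y0 tx m.
have X0 : 0 < rnorm x ^+ 2 by rewrite exprn_gt0 ?rnorm_gt0.
have Y0 : 0 < rnorm y ^+ 2 by rewrite exprn_gt0 ?rnorm_gt0.
have := tx (line_coef x y).
rewrite -(ler_pM2r Y0) sqr_dist_line_min // => h.
rewrite -(ler_pM2r X0) sqr_dist_line dotC cmodJ.
rewrite -[leLHS]addr0 lerD ?sqr_ge0 //; apply: le_trans (le_trans h _).
  by rewrite mulrAC.
by rewrite [_ * rnorm x ^+ 2]mulrC.
Qed.

End InnerProduct.

(** * Descent of a sesquilinear form *)

(** The real inequality behind one descent step. In [descent], [n] is the
    squared norm of z + c w, the gain [- s ^+ 2 * g] of second order outweighs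
    the imaginary part, of fourth order in [s] after squaring, and the first
    order term [- s * x] only helps. The value of [s] makes the total real
    change at most [a * n], so that the real part does not overshoot 0. *)
Lemma descent_arith (R : realFieldType) (C eps s a x g y n : R) :
  0 < eps -> eps <= a -> a <= C -> s * (24 * C) = eps ->
  0 <= x <= 4 * C -> - (2 * C) <= g -> g <= - (a / 2) -> `|y| <= 2 * C ->
  1 / 4 <= n -> n <= 4 ->
  (a * n + (s ^+ 2 * g - s * x)) ^+ 2 + (s ^+ 2 * y) ^+ 2 <=
  (a ^+ 2 - s ^+ 2 * eps ^+ 2 / 256) * n ^+ 2.
Proof.
move=> e0 ea aC sE /andP[x0 xC] gl gu yC nl nu.
have C0 : 0 < C by lra.
have s0 : 0 < s by rewrite -(pmulr_lgt0 _ (_ : 0 < 24 * C)) ?sE //; lra.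
have s1 : s <= 1 / 24.
  by rewrite -(ler_pM2r (_ : 0 < 24 * C)) ?sE //; lra.
set P := s * x - s ^+ 2 * g.
have P1 : s ^+ 2 * (a / 2) <= P.
  have : 0 <= s * x by rewrite mulr_ge0 // ltW.
  have : s ^+ 2 * (a / 2) <= s ^+ 2 * (- g) by rewrite ler_pM2l ?exprn_gt0 //; lra.
  rewrite /P; lra.
have P2 : P <= a * n.
  have : s * x <= s * (4 * C) by rewrite ler_pM2l.
  have : s ^+ 2 * (- g) <= s ^+ 2 * (2 * C) by rewrite ler_pM2l ?exprn_gt0 //; lra.
  have : s ^+ 2 * (2 * C) <= s * (2 * C).
    by rewrite ler_pM2r ?expr2 1?ler_piMl //; lra.
  have : a * (1 / 4) <= a * n by rewrite ler_pM2l //; lra.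
  rewrite /P; lra.
have P3 : (a * n - P) ^+ 2 <= a ^+ 2 * n ^+ 2 - a * n * P.
  have : P * P <= P * (a * n).
    by rewrite ler_wpM2l // (le_trans _ P1) // mulr_ge0 ?sqr_ge0 //; lra.
  rewrite sqrrB exprMn -expr2; lra.
have P4 : eps * (1 / 4) * (s ^+ 2 * (eps / 2)) <= a * n * P.
  apply: ler_pM.
  - lra.
  - by rewrite mulr_ge0 ?sqr_ge0 //; lra.
  - by apply: ler_pM => //; lra.
  - by apply: le_trans P1; rewrite ler_pM2l ?exprn_gt0 //; lra.
have P5 : (s ^+ 2 * y) ^+ 2 <= s ^+ 2 * (s ^+ 2 * (4 * C ^+ 2)).
  rewrite exprMn expr2 -mulrA ler_pM2l ?exprn_gt0 // ler_pM2l ?exprn_gt0 //.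
  have -> : 4 * C ^+ 2 = (2 * C) ^+ 2 by ring.
  by rewrite -(real_normK (num_real y)) ler_pXn2r ?nnegrE //; lra.
have P6 : s ^+ 2 * (4 * C ^+ 2) = eps ^+ 2 / 144 by rewrite -sE; field.
rewrite P6 in P5.
have P7 : s ^+ 2 * eps ^+ 2 / 256 * n ^+ 2 <= s ^+ 2 * eps ^+ 2 / 256 * 16.
  have n16 : n ^+ 2 <= 16 by nra.
  rewrite ler_wpM2l // divr_ge0 // mulr_ge0 ?sqr_ge0 //.
have T0 : 0 <= s ^+ 2 * eps ^+ 2 by rewrite mulr_ge0 ?sqr_ge0.
have -> : a * n + (s ^+ 2 * g - s * x) = a * n - P by rewrite /P; ring.
rewrite mulrBl; move: P3 P4 P5 P7 T0; lra.
Qed.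

Section Descent.
Context {R : realType} {H : completeNormedModType R[i]}.
Variable dot : {dot H for Num.conj}.
Hypothesis norm_dot : forall x : H, `|x| = sqrtC (dot x x).
Variables (f : H -> H -> R[i]) (C eps : R).
Hypotheses (sesqui_f : is_sesqui f) (C_gt0 : 0 < C) (eps_gt0 : 0 < eps).
Hypothesis f_bounded : forall x y, cmod (f x y) <= C * (rnorm x * rnorm y).

Let s := eps / (24 * C).

(** The vector z + c w with c = s u is compared with z through the form
    h = f - f(z, z) (., .), which vanishes at (z, z) and absorbs the change of
    the norm. The phase u is chosen so that th^* times the cross term of h is
    real and nonpositive: any imaginary part of first order could cancel the
    gain of second order provided by h(w, w). *)
Lemma descent (z w : H) :
  rnorm z = 1 -> rnorm w = 1 -> eps <= cmod (f z z) ->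
  complex.Re ((f z z)^* * f w w) <= cmod (f z z) * (eps / 2) ->
  exists c : R[i], let v := z + c *: w in
  [/\ cmod c = s, 1 / 4 <= rnorm v ^+ 2 &
      cmod (f v v) ^+ 2 <=
      (cmod (f z z) ^+ 2 - s ^+ 2 * eps ^+ 2 / 256) * (rnorm v ^+ 2) ^+ 2].
Proof.
move=> z1 w1 ea Re_le; set a := cmod (f z z) in ea Re_le *.
have a_gt0 : 0 < a by exact: lt_le_trans ea.
have aC : a <= C by have := f_bounded z z; rewrite z1 !mulr1.
have s_eq : s * (24 * C) = eps by rewrite /s divfK //; lra.
have s_gt0 : 0 < s by rewrite /s divr_gt0 //; lra.
have s_le : s <= 1 / 24.
  rewrite /s ler_pdivrMr; lra.
set th := f z z * (a^-1)%:C.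
have th1 : cmod th = 1.
  by rewrite cmodM cmodR ?invr_ge0 ?cmod_ge0 // -/a mulfV // gt_eqF.
have thE : f z z = a%:C * th.
  rewrite /th mulrCA -(rmorphM (real_complex R)) mulfV ?gt_eqF //.
  by rewrite rmorph1 mulr1.
have thJ : th^* * th = 1 by rewrite mulrC mulcJ th1 expr1n.
pose h x y := f x y - f z z * dot x y.
have sh : is_sesqui h.
  have [fDl fDr fZl fZr] := sesqui_f.
  have [dDl dDr dZl dZr] := sesqui_dot dot.
  rewrite /h; split=> *.
  - by rewrite fDl dDl; ring.
  - by rewrite fDr dDr; ring.
  - by rewrite fZl dZl; ring.
  - by rewrite fZr dZr; ring.
have h_bounded x y : cmod (h x y) <= 2 * C * (rnorm x * rnorm y).
  rewrite (le_trans (cmodD _ _)) // cmodN cmodM -/a.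
  have := f_bounded x y; have := cmod_dot_le norm_dot x y.
  have : 0 <= rnorm x * rnorm y by rewrite mulr_ge0 ?rnorm_ge0.
  have := cmod_ge0 (dot x y); nra.
have hzz : h z z = 0.
  by rewrite /h (dot_diag norm_dot) z1 expr1n mulr1 subrr.
have [u [x u1 [/andP[x_ge0 x_le] uE]]] :=
  real_nonpos_phase (th^* * h z w) (th^* * h w z).
have x_le4 : x <= 4 * C.
  apply: le_trans x_le _; rewrite !cmodM cmodJ th1 !mul1r.
  have := h_bounded z w; have := h_bounded w z; rewrite z1 w1; lra.
exists (s%:C * u); set v := z + _.
have cs : cmod (s%:C * u) = s by rewrite cmodM u1 mulr1 cmodR // ltW.
have v_le : rnorm v <= 1 + s.
  by rewrite (le_trans (rnormD _ _)) // rnormZ cs z1 w1 mulr1.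
have v_ge : 1 - s <= rnorm v.
  have : rnorm z <= rnorm v + s.
    have {1}-> : z = v - (s%:C * u) *: w by rewrite /v addrK.
    by rewrite (le_trans (rnormD _ _)) // rnormN rnormZ cs w1 mulr1.
  by rewrite z1; lra.
have n_ge : 1 / 4 <= rnorm v ^+ 2 by nra.
have n_le : rnorm v ^+ 2 <= 4 by nra.
split=> //.
pose G := th^* * h w w.
have fvE : th^* * f v v =
    (a * rnorm v ^+ 2 - s * x)%:C + (s ^+ 2)%:C * G.
  have -> : f v v = h v v + f z z * (rnorm v ^+ 2)%:C.
    by rewrite /h (dot_diag norm_dot) subrK.
  rewrite (sesqui_diag_line _ _ _ sh) hzz add0r cs mulrDr.
  transitivity (s%:C * (u^* * (th^* * h z w) + u * (th^* * h w z)) +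
     (s ^+ 2)%:C * G + (th^* * th) * a%:C * (rnorm v ^+ 2)%:C).
    rewrite /G thE.
    rewrite conjcZ; ring.
  rewrite uE thJ mul1r; apply/eqP; rewrite eq_complex /=; apply/andP.
  by case: (G) => g1 g2 /=; split; apply/eqP; ring.
have ReG : complex.Re G <= - (a / 2).
  have -> : complex.Re G = complex.Re ((f z z)^* * f w w) / a - a.
    have -> : G = th^* * f w w - a%:C.
      rewrite /G /h (dot_diag norm_dot) w1 expr1n mulr1 mulrBr thE.
      by rewrite mulrCA thJ mulr1.
    have -> : (f z z)^* * f w w = a%:C * (th^* * f w w).
      by rewrite thE conjcZ mulrA.
    have a0 := lt0r_neq0 a_gt0.
    by case: (th^* * f w w) => g1 g2 /=; field.
  have : complex.Re ((f z z)^* * f w w) / a <= eps / 2.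
    by rewrite ler_pdivrMr // [eps / 2 * _]mulrC.
  lra.
have Gle : cmod G <= 2 * C.
  rewrite cmodM cmodJ th1 mul1r; have := h_bounded w w.
  by rewrite w1 !mulr1.
have -> : cmod (f v v) ^+ 2 =
    (a * rnorm v ^+ 2 + (s ^+ 2 * complex.Re G - s * x)) ^+ 2 +
    (s ^+ 2 * complex.Im G) ^+ 2.
  transitivity (cmod (th^* * f v v) ^+ 2).
    by rewrite cmodM cmodJ th1 mul1r.
  rewrite fvE sqr_cmod; case: (G) => g1 g2 /=; ring.
apply: (@descent_arith _ C eps) => //.
- by rewrite x_ge0.
- have := normRe_cmod G; rewrite ler_norml => /andP[+ _]; lra.
- exact: le_trans (normIm_cmod G) Gle.
Qed.

(** In the application [q] measures by how much a vector fails to maximize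
    |Ax|; the last hypothesis expresses the optimality of l. *)
Variable q : H -> R.
Hypotheses (q_ge0 : forall x, 0 <= q x)
  (qZ : forall c x, q (c *: x) = cmod c ^+ 2 * q x)
  (q_parallelogram : forall x y, q (x + y) + q (x - y) = 2 * q x + 2 * q y).
Hypothesis f_sees_all_directions : forall (d : R) (th : R[i]),
  0 < d -> cmod th = 1 ->
  exists w, [/\ rnorm w = 1, q w <= d &
                complex.Re (th^* * f w w) <= eps / 2].

(** The factor 16 is 4, from the parallelogram law q(z + c w) <= 2 q(z) +
    2 q(c w), times 4, from the normalization of a vector of norm at least
    1/2. *)
Lemma descent_step (d : R) (z : H) : 0 < d -> rnorm z = 1 -> q z <= d ->
  eps <= cmod (f z z) ->
  exists2 v, rnorm v = 1 & q v <= 16 * d /\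
    cmod (f v v) ^+ 2 <= cmod (f z z) ^+ 2 - s ^+ 2 * eps ^+ 2 / 256.
Proof.
move=> d0 z1 qz ea; set a := cmod (f z z).
have a0 : 0 < a by exact: lt_le_trans ea.
have C24 : eps <= C.
  by apply: (le_trans ea); have := f_bounded z z; rewrite z1 !mulr1.
have s_ge0 : 0 <= s by rewrite /s divr_ge0 ?mulr_ge0 ?ltW.
have s_le1 : s <= 1.
  rewrite /s ler_pdivrMr ?mul1r ?mulr_gt0 // (le_trans C24) //.
  by rewrite ler_peMl ?ler1n // ltW.
have s1 : s ^+ 2 <= 1 by rewrite expr_le1.
have ain : 0 <= a^-1 by rewrite invr_ge0 ltW.
have [|w [w1 qw Re_le]] := @f_sees_all_directions d (f z z * (a^-1)%:C) d0.
  by rewrite cmodM cmodR // mulfV // gt_eqF.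
have [|c [cs v_ge v_le]] := @descent z w z1 w1 ea.
  rewrite -/a [a * _]mulrC -ler_pdivrMr //; apply: le_trans Re_le.
  rewrite [f z z * _]mulrC conjcZ le_eqVlt; apply/orP; left; apply/eqP.
  by case: (f z z) (f w w) => [? ?] [? ?] /=; ring.
set v := z + c *: w in v_ge v_le.
have vn0 : 0 < rnorm v by have := rnorm_ge0 v; nra.
have v0 : v != 0 by rewrite -rnorm_gt0.
have in0 : 0 <= (rnorm v)^-1 by rewrite invr_ge0 ltW.
have qv : q v <= 4 * d.
  have := q_parallelogram z (c *: w); rewrite -/v qZ cs.
  clear Re_le v_le; have := q_ge0 (z - c *: w); have := q_ge0 w; nra.
exists (((rnorm v)^-1)%:C *: v); first exact: normalize.
split.
  rewrite qZ cmodR // exprVn ler_pdivrMl ?exprn_gt0 //; nra.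
rewrite sesqui_diagZ // cmodM !cmodR ?exprn_ge0 // exprMn !exprVn.
by rewrite mulrC ler_pdivrMr ?exprn_gt0.
Qed.

(** The number of descent steps depends on [C] and [eps] only, while the
    defect grows by a fixed factor at each step; starting from a defect
    divided by the corresponding power of 16 leaves it below [d]. *)
Theorem small_form_value (d : R) : 0 < d ->
  exists z, [/\ rnorm z = 1, q z <= d & cmod (f z z) <= eps].
Proof.
pose k := s ^+ 2 * eps ^+ 2 / 256.
have k0 : 0 < k.
  by rewrite /k /s divr_gt0 // mulr_gt0 // exprn_gt0 // divr_gt0 // mulr_gt0.
have P n : forall d, 0 < d -> exists z, [/\ rnorm z = 1, q z <= d &
    cmod (f z z) <= eps \/ cmod (f z z) ^+ 2 <= C ^+ 2 - n%:R * k].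
  (* the defect is quantified inside, so that it can shrink with n *)
  elim: n => [|n IHn] {}d d0.
    have [|w [w1 qw _]] := @f_sees_all_directions d 1 d0.
      exact: Normc.normc1.
    exists w; split=> //; right; rewrite mul0r subr0.
    rewrite ler_pXn2r ?nnegrE ?cmod_ge0 ?(ltW C_gt0) //.
    by have := f_bounded w w; rewrite w1 !mulr1.
  have [|z [z1 qz zP]] := IHn (d / 16); first by rewrite divr_gt0.
  have [|ea] := leP (cmod (f z z)) eps.
    by exists z; split=> //; [lra|left].
  case: zP => [|zP]; first by rewrite leNgt ea.
  have [|v v1 [qv vP]] := @descent_step (d / 16) z _ z1 qz (ltW ea).
    by rewrite divr_gt0.
  exists v; split=> //; first by lra.
  right; rewrite mulrSr mulrDl mul1r; move: vP; rewrite -/k; lra.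
move=> /(P (Num.truncn (C ^+ 2 / k)).+1)[z [z1 qz [zP|zP]]]; first by exists z.
exists z; split=> //.
have : C ^+ 2 < (Num.truncn (C ^+ 2 / k)).+1%:R * k.
  by rewrite -ltr_pdivrMr // truncnS_gt.
have := sqr_ge0 (cmod (f z z)); lra.
Qed.

End Descent.

(** * Operator norms *)

Section OperatorNorm.
Context {R : realType} {H : completeNormedModType R[i]}.
Hypothesis H_neq0 : exists x : H, x != 0.
Implicit Types (T : H -> H).

Lemma unit_vector_exists : exists x : H, rnorm x = 1.
Proof.
by have [x x0] := H_neq0; exists (((rnorm x)^-1)%:C *: x); exact: normalize.
Qed.

Lemma opnorm_le T (M : R) : 0 <= M ->
  (forall x, rnorm (T x) <= M * rnorm x) -> opnorm T <= M.
Proof.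
move=> M0 TM; apply: ge_sup.
  by exists (rnorm (T 0)), 0 => //=; rewrite rnorm0.
move=> _ [x /= x1 <-]; apply: (le_trans (TM x)).
by rewrite -[leRHS]mulr1 ler_wpM2l.
Qed.

Lemma bounded_pos T : bounded_operator T ->
  exists2 M : R, 0 < M & forall x, rnorm (T x) <= M * rnorm x.
Proof.
case=> M TM; exists (`|M| + 1); first by rewrite ltr_wpDl.
move=> x; apply: (le_trans (TM x)); rewrite ler_wpM2r ?rnorm_ge0 //.
by rewrite (le_trans (ler_norm _)) // lerDl.
Qed.

Lemma homogeneous0 T : (forall c x, T (c *: x) = c *: T x) -> T 0 = 0.
Proof. by move=> TZ; rewrite -[X in T X](scale0r 0) TZ scale0r. Qed.

Lemma le_opnorm T : (forall c x, T (c *: x) = c *: T x) -> bounded_operator T ->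
  forall x, rnorm (T x) <= opnorm T * rnorm x.
Proof.
move=> TZ /bounded_pos[M M0 TM] x.
have [->|x0] := eqVneq x 0.
  by rewrite homogeneous0 // rnorm0 mulr0.
have rx0 : 0 < rnorm x by rewrite rnorm_gt0.
rewrite -ler_pdivrMr //; apply: sup_upper_bound.
  split; first by exists (rnorm (T 0)), 0 => //=; rewrite rnorm0.
  exists M => _ [y /= y1 <-]; apply: (le_trans (TM y)).
  by rewrite -[leRHS]mulr1 ler_wpM2l // ltW.
exists (((rnorm x)^-1)%:C *: x) => /=; first by rewrite normalize.
by rewrite TZ rnormZ cmodR ?invr_ge0 ?rnorm_ge0 // mulrC.
Qed.

Lemma opnorm_ge0 T : (forall c x, T (c *: x) = c *: T x) -> bounded_operator T ->
  0 <= opnorm T.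
Proof.
move=> TZ Tb; have [x x1] := unit_vector_exists.
by have := le_opnorm TZ Tb x; rewrite x1 mulr1; exact: le_trans (rnorm_ge0 _).
Qed.

Lemma opnorm_almost_attained T (e : R) :
  (forall c x, T (c *: x) = c *: T x) -> bounded_operator T -> 0 < e ->
  exists2 x, rnorm x = 1 & opnorm T ^+ 2 - e <= rnorm (T x) ^+ 2.
Proof.
move=> TZ Tb e0; have N0 := opnorm_ge0 TZ Tb.
apply: contrapT => nx.
have small x : rnorm x = 1 -> rnorm (T x) ^+ 2 < opnorm T ^+ 2 - e.
  by move=> x1; rewrite ltNge; apply/negP => xe; apply: nx; exists x.
have [x0 x01] := unit_vector_exists.
have Me0 : 0 <= opnorm T ^+ 2 - e.
  by apply: ltW; apply: le_lt_trans (small _ x01); exact: sqr_ge0.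
have : opnorm T <= Num.sqrt (opnorm T ^+ 2 - e).
  apply: opnorm_le => [|x]; first exact: sqrtr_ge0.
  have [->|xn0] := eqVneq x 0.
    by rewrite homogeneous0 // rnorm0 mulr0.
  rewrite -ler_pdivrMr ?rnorm_gt0 //.
  have -> : rnorm (T x) / rnorm x = rnorm (T (((rnorm x)^-1)%:C *: x)).
    by rewrite TZ rnormZ cmodR ?invr_ge0 ?rnorm_ge0 // mulrC.
  rewrite -(ler_pXn2r (n := 2)) ?nnegrE ?rnorm_ge0 ?sqrtr_ge0 //.
  by rewrite sqr_sqrtr // ltW // small // normalize.
rewrite -(ler_pXn2r (n := 2)) ?nnegrE ?sqrtr_ge0 // sqr_sqrtr //.
by rewrite leNgt ltrBlDr ltrDl e0.
Qed.

Lemma attains_infP (f : R[i] -> R) l : (forall m, 0 <= f m) ->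
  attains_inf f l <-> forall m, f l <= f m.
Proof.
move=> f0; rewrite /attains_inf; split=> [-> m|lm].
  by apply: inf_lbound; [exists 0 => _ [x _ <-]|exists m].
apply/le_anti/andP; split.
  by apply: lb_le_inf; [exists (f l), l|move=> _ [x _ <-]].
by apply: inf_lbound; [exists 0 => _ [x _ <-]|exists l].
Qed.

End OperatorNorm.

(** * Minimizers of the norm of I - l B *)

Section Pencil.
Context {R : realType} {H : completeNormedModType R[i]}.
Hypothesis H_neq0 : exists x : H, x != 0.
Variables (B : {linear H -> H}) (b : R).
Hypotheses (b_gt0 : 0 < b) (B_le : forall x, rnorm (B x) <= b * rnorm x).

Definition pencil (l : R[i]) (x : H) : H := x - l *: B x.

Lemma pencilZ l c x : pencil l (c *: x) = c *: pencil l x.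
Proof. by rewrite /pencil [B (c *: x)]linearZ /= scalerBr !scalerA mulrC. Qed.

Lemma pencilD l x y : pencil l (x + y) = pencil l x + pencil l y.
Proof. by rewrite /pencil linearD /= scalerDr opprD addrACA. Qed.

Lemma pencil_shift l m x : pencil (l + m) x = pencil l x - m *: B x.
Proof. by rewrite /pencil scalerDl opprD addrA. Qed.

Lemma pencil_bounded l : bounded_operator (pencil l).
Proof.
exists (1 + cmod l * b) => x; rewrite (le_trans (rnormD _ _)) // rnormN rnormZ.
by rewrite mulrDl mul1r lerD2l -mulrA ler_wpM2l ?cmod_ge0.
Qed.

Lemma le_opnorm_pencil l x : rnorm (pencil l x) <= opnorm (pencil l) * rnorm x.
Proof. apply: le_opnorm; [exact: pencilZ|exact: pencil_bounded]. Qed.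

Lemma opnorm_pencil_ge0 l : 0 <= opnorm (pencil l).
Proof. by apply: opnorm_ge0 => //; [exact: pencilZ|exact: pencil_bounded]. Qed.

Lemma opnorm_pencil_lipschitz l m :
  opnorm (pencil l) <= opnorm (pencil m) + cmod (m - l) * b.
Proof.
apply: opnorm_le.
  by rewrite addr_ge0 ?opnorm_pencil_ge0 // mulr_ge0 ?cmod_ge0 // ltW.
move=> x; have -> : pencil l x = pencil m x + (m - l) *: B x.
  by rewrite /pencil scalerBl addrA subrK.
rewrite (le_trans (rnormD _ _)) // mulrDl lerD ?le_opnorm_pencil //.
by rewrite rnormZ -mulrA ler_wpM2l ?cmod_ge0.
Qed.

(** Continuity on a compact square gives a minimizer there. The half side [r]
    is such that, for |m| >= r, the vector [x] alone shows that |I - m B| is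
    at least 1, which bounds the norm for m = 0. *)
Lemma opnorm_pencil_minimizer : (exists x, B x != 0) ->
  exists l, forall m, opnorm (pencil l) <= opnorm (pencil m).
Proof.
case=> x Bx0; pose F (p : R * R) := opnorm (pencil (p.1 +i* p.2)).
have rBx0 : 0 < rnorm (B x) by rewrite rnorm_gt0.
pose r := 2 * rnorm x / rnorm (B x).
have r0 : 0 <= r by rewrite divr_ge0 ?mulr_ge0 ?rnorm_ge0.
pose K := `[- r, r] `*` `[- r, r] : set (R * R).
have K0 : K !=set0.
  by exists (0, 0); split => /=; rewrite in_itv /= oppr_le0 r0.
have cK : compact K by apply: compact_setX; exact: segment_compact.
have cF : continuous F.
  move=> p; apply/cvgrPdist_lt => e e0.
  have d0 : 0 < e / (2 * b) by rewrite divr_gt0 // mulr_gt0.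
  exists (ball p.1 (e / (2 * b)), ball p.2 (e / (2 * b))) => /=.
    by split; exact: nbhsx_ballx.
  case=> u v [/= up vp].
  have Fle (p1 p2 : R * R) : `|p1.1 - p2.1| < e / (2 * b) ->
      `|p1.2 - p2.2| < e / (2 * b) -> F p1 - F p2 < e.
    move=> h1 h2; rewrite ltrBlDl.
    apply: (le_lt_trans (opnorm_pencil_lipschitz (p1.1 +i* p1.2) (p2.1 +i* p2.2))).
    rewrite ltrD2l -ltr_pdivlMr //.
    have : cmod (p2.1 +i* p2.2 - p1.1 +i* p1.2) <=
        `|p1.1 - p2.1| + `|p1.2 - p2.2|.
      rewrite -(ler_pXn2r (n := 2)) ?nnegrE ?cmod_ge0 ?addr_ge0 //.
      rewrite sqr_cmod /= [leRHS]sqrrD !real_normK ?num_real //.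
      have : 0 <= `|p1.1 - p2.1| * `|p1.2 - p2.2| by rewrite mulr_ge0.
      lra.
    have -> : e / b = e / (2 * b) + e / (2 * b) by field; rewrite gt_eqF.
    lra.
  rewrite ltr_norml; apply/andP; split; last exact: Fle.
  rewrite ltrNl opprB; apply: Fle; rewrite distrC //.
have [p _ pmin] := compact_EVT_min K0 cK (continuous_subspaceT cF).
exists (p.1 +i* p.2) => m.
have [mK|mK] := boolP ((complex.Re m, complex.Im m) \in K).
  have := pmin _ mK; rewrite /F /=; congr (_ <= opnorm (pencil _)).
  by case: (m).
have : F p <= F (0, 0).
  by apply: pmin; rewrite inE; split; rewrite /= in_itv /= oppr_le0 r0.
move/le_trans; apply.
have : r <= cmod m.
  rewrite leNgt; apply: contra mK => mr; rewrite inE.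
  have [h1 h2] := (normRe_cmod m, normIm_cmod m).
  by split; rewrite /= in_itv /= -ler_norml ltW //; exact: le_lt_trans mr.
rewrite /r ler_pdivrMr // => rm.
have xm := le_opnorm_pencil m x.
have x_gt0 : 0 < rnorm x.
  by rewrite rnorm_gt0; apply: contraNneq Bx0 => ->; rewrite linear0.
have : cmod m * rnorm (B x) <= rnorm (pencil m x) + rnorm x.
  have : m *: B x = x - pencil m x by rewrite /pencil opprB addrC subrK.
  rewrite -rnormZ => ->; rewrite addrC (le_trans (rnormD _ _)) // rnormN.
  by rewrite addrC.
have F0 : F (0, 0) <= 1.
  apply: opnorm_le => // y; rewrite /pencil.
  have -> : 0 +i* 0 = 0 :> R[i] by [].
  by rewrite scale0r subr0 mul1r.
move=> h; apply: (le_trans F0); rewrite -(ler_pM2r x_gt0) mul1r; lra.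
Qed.

Variable dot : {dot H for Num.conj}.
Hypothesis norm_dot : forall x : H, `|x| = sqrtC (dot x x).
Variable l : R[i].
Hypothesis l_min : forall m, opnorm (pencil l) <= opnorm (pencil m).

Let N := opnorm (pencil l).
Let f x y := dot (pencil l x) (B y).
Let q x := N ^+ 2 * rnorm x ^+ 2 - rnorm (pencil l x) ^+ 2.

Let sesqui_f : is_sesqui f.
Proof.
have [dDl dDr dZl dZr] := sesqui_dot dot; rewrite /f; split=> *.
- by rewrite pencilD dDl.
- by rewrite linearD dDr.
- by rewrite pencilZ dZl.
- by rewrite linearZ dZr.
Qed.

Let f_bounded x y : cmod (f x y) <= (N + 1) * b * (rnorm x * rnorm y).
Proof.
apply: (le_trans (cmod_dot_le norm_dot _ _)).
have -> : (N + 1) * b * (rnorm x * rnorm y) =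
          ((N + 1) * rnorm x) * (b * rnorm y) by ring.
apply: ler_pM; rewrite ?rnorm_ge0 //.
by apply: (le_trans (le_opnorm_pencil _ _)); rewrite ler_wpM2r ?rnorm_ge0 ?lerDl.
Qed.

Let q_ge0 x : 0 <= q x.
Proof.
rewrite /q subr_ge0 -exprMn ler_pXn2r ?nnegrE ?mulr_ge0 ?rnorm_ge0 //.
  exact: le_opnorm_pencil.
exact: opnorm_pencil_ge0.
Qed.

Let qZ c x : q (c *: x) = cmod c ^+ 2 * q x.
Proof. by rewrite /q pencilZ !sqr_rnormZ; ring. Qed.

Let q_parallelogram x y : q (x + y) + q (x - y) = 2 * q x + 2 * q y.
Proof.
have pB : pencil l (x - y) = pencil l x - pencil l y.
  by rewrite -scaleN1r pencilD pencilZ scaleN1r.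
have := parallelogram norm_dot x y.
have := parallelogram norm_dot (pencil l x) (pencil l y).
rewrite /q pencilD pB.
set X1 := rnorm (_ + _) ^+ 2; set X2 := rnorm (_ - _) ^+ 2.
set X3 := rnorm (pencil l x) ^+ 2; set X4 := rnorm (pencil l y) ^+ 2.
set Y1 := rnorm (x + y) ^+ 2; set Y2 := rnorm (x - y) ^+ 2.
set Y3 := rnorm x ^+ 2; set Y4 := rnorm y ^+ 2.
move=> E1 E2.
have -> : N ^+ 2 * Y1 - X1 + (N ^+ 2 * Y2 - X2) =
  N ^+ 2 * (Y1 + Y2) - (X1 + X2) by ring.
by rewrite E1 E2; ring.
Qed.

(** Since |I - (l + t th) B| >= N, some unit vector w satisfies
    |Aw - t th Bw|^2 >= N^2 - t^2. Expanding the square and using |Aw| <= N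
    gives 2 t Re (th^* f(w)) <= t^2 (1 + b^2); bounding Re (th^* f(w)) from
    below instead gives q(w) = O(t). *)
Let f_sees_all_directions (e d : R) (th : R[i]) : 0 < e -> 0 < d -> cmod th = 1 ->
  exists w, [/\ rnorm w = 1, q w <= d & complex.Re (th^* * f w w) <= e / 2].
Proof.
move=> e0 d0 th1; have N0 : 0 <= N by exact: opnorm_pencil_ge0.
pose L := 1 + 2 * (N + 1) * b + b ^+ 2.
have L1 : 1 <= L.
  rewrite /L -addrA lerDl addr_ge0 ?sqr_ge0 //.
  by rewrite !mulr_ge0 ?addr_ge0 // ltW.
pose t := Num.min 1 (Num.min e d / L).
have L0 : 0 < L by lra.
have t0 : 0 < t by rewrite lt_min ltr01 divr_gt0 // lt_min e0.
have t1 : t <= 1 by rewrite ge_min lexx.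
have tL : t * L <= Num.min e d by rewrite -ler_pdivlMr // ge_min lexx orbT.
have te : t * L <= e by rewrite (le_trans tL) // ge_min lexx.
have td : t * L <= d by rewrite (le_trans tL) // ge_min lexx orbT.
have tt0 : 0 < t ^+ 2 by rewrite exprn_gt0.
have [w w1 wN] := opnorm_almost_attained H_neq0 (pencilZ (l + t%:C * th))
   (pencil_bounded _) tt0.
have {}wN : N ^+ 2 - t ^+ 2 <= rnorm (pencil (l + t%:C * th) w) ^+ 2.
  apply: le_trans wN; rewrite lerD2r ler_pXn2r ?nnegrE ?opnorm_pencil_ge0 //.
pose ReF := complex.Re (th^* * f w w).
have E : rnorm (pencil (l + t%:C * th) w) ^+ 2 =
    rnorm (pencil l w) ^+ 2 - 2 * t * ReF + t ^+ 2 * rnorm (B w) ^+ 2.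
  rewrite pencil_shift -scaleNr (sqr_rnormD norm_dot) sqr_rnormZ cmodN cmodM th1 mulr1.
  rewrite cmodR ?ltW //.
  have [_ _ _ ->] := sesqui_dot dot.
  rewrite /ReF /f [(- _)^*]rmorphN /= conjcZ.
  by case: (th^*) (dot _ _) => [? ?] [? ?] /=; ring.
have Bw : rnorm (B w) ^+ 2 <= b ^+ 2.
  rewrite ler_pXn2r ?nnegrE ?rnorm_ge0 ?(ltW b_gt0) //.
  by have := B_le w; rewrite w1 mulr1.
have qw0 := q_ge0 w.
have Aw : rnorm (pencil l w) ^+ 2 <= N ^+ 2.
  by move: qw0; rewrite /q w1 expr1n mulr1 subr_ge0.
have ReF_le : `|ReF| <= (N + 1) * b.
  apply: (le_trans (normRe_cmod _)); rewrite cmodM cmodJ th1 mul1r.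
  by have := f_bounded w w; rewrite w1 !mulr1.
have tB : t ^+ 2 * rnorm (B w) ^+ 2 <= t ^+ 2 * b ^+ 2.
  by rewrite ler_wpM2l ?sqr_ge0.
have Nb0 : 0 <= (N + 1) * b by rewrite mulr_ge0 ?addr_ge0 // ltW.
have t2 : t ^+ 2 * (1 + b ^+ 2) <= t * (1 + b ^+ 2).
  rewrite ler_wpM2r ?addr_ge0 ?sqr_ge0 // expr2.
  by rewrite -[leRHS]mulr1 ler_wpM2l // ltW.
have tN : t * ReF <= t * ((N + 1) * b).
  by rewrite ler_wpM2l ?(ltW t0) // (le_trans (ler_norm _)).
have tN' : - (t * ReF) <= t * ((N + 1) * b).
  by rewrite -mulrN ler_wpM2l ?(ltW t0) // (le_trans (ler_norm _)) ?normrN.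
exists w; split=> //.
  apply: le_trans td; rewrite /q w1 expr1n mulr1.
  rewrite E in wN; rewrite /L; clear -wN tB t2 tN tN'; lra.
rewrite -/ReF -(ler_pM2l t0) -(ler_pM2l (ltr0n R 2)).
apply: (@le_trans _ _ (t * (t * L))); last first.
  have := ler_wpM2l (ltW t0) te; lra.
rewrite E in wN.
have : t ^+ 2 * (1 + b ^+ 2) <= t * (t * L).
  rewrite mulrA -expr2 ler_wpM2l ?sqr_ge0 // /L; lra.
clear -wN tB Aw; lra.
Qed.

(** A first order optimality condition: the values (Az, Bz) taken along almost
    maximizing vectors z of |Az| accumulate at 0. *)
Lemma near_extremal_vector (e : R) : 0 < e -> exists z,
  [/\ rnorm z = 1, N ^+ 2 - e <= rnorm (pencil l z) ^+ 2 &
      cmod (dot (pencil l z) (B z)) <= e].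
Proof.
move=> e0.
have C0 : 0 < (N + 1) * b.
  by rewrite mulr_gt0 // ltr_wpDl ?opnorm_pencil_ge0.
have [z [z1 qz fz]] := small_form_value norm_dot sesqui_f C0 e0 f_bounded
   q_ge0 qZ q_parallelogram (fun d th => @f_sees_all_directions e d th e0) e0.
exists z; split=> //; move: qz; rewrite /q z1 expr1n mulr1; lra.
Qed.

Variable b' : R.
Hypotheses (b'_gt0 : 0 < b') (B_ge : forall x, rnorm x <= b' * rnorm (B x)).

(** Both conclusions are Pythagoras on the line of Bz: the almost orthogonality
    of Az and Bz means that l is almost the coefficient of the projection of
    z. The lower bound on |Bz| makes the errors uniform. *)
Lemma extremal_vector (e : R) : 0 < e -> exists z,
  [/\ rnorm z = 1, forall m, N ^+ 2 - e <= rnorm (pencil m z) ^+ 2 &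
      cmod (dot z (B z) / (rnorm (B z) ^+ 2)%:C - l) <= e].
Proof.
move=> e0; pose d := Num.min 1 (e / (1 + b' ^+ 2)).
have b1 : 0 < 1 + b' ^+ 2 by rewrite ltr_pwDl ?sqr_ge0.
have d0 : 0 < d by rewrite lt_min ltr01 divr_gt0.
have d1 : d <= 1 by rewrite ge_min lexx.
have de : d * (1 + b' ^+ 2) <= e by rewrite -ler_pdivlMr // ge_min lexx orbT.
have [z [z1 zN zf]] := near_extremal_vector d0.
have Bz1 : 1 <= b' * rnorm (B z) by rewrite -z1.
have Bz0 : 0 < rnorm (B z).
  by rewrite -(pmulr_rgt0 _ b'_gt0); lra.
have Bz2 : 1 <= b' ^+ 2 * rnorm (B z) ^+ 2.
  by rewrite -exprMn expr_ge1 // mulr_ge0 ?rnorm_ge0 // ltW.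
have BB0 : 0 < rnorm (B z) ^+ 2 by rewrite exprn_gt0.
have zf2 : cmod (dot (pencil l z) (B z)) ^+ 2 <= d ^+ 2.
  by rewrite ler_pXn2r ?nnegrE ?cmod_ge0 // ltW.
have dd : d ^+ 2 <= d by rewrite expr2 -[leRHS]mulr1 ler_wpM2l // ltW.
exists z; split=> // [m|].
  have := sqr_dist_line norm_dot (pencil l z) (B z) (m - l).
  rewrite -pencil_shift addrC subrK => E.
  rewrite -(ler_pM2r BB0) E -[leLHS]addr0 lerD ?sqr_ge0 //.
  have : 0 <= d * (b' ^+ 2 * rnorm (B z) ^+ 2 - 1).
    by rewrite mulr_ge0 ?subr_ge0 // ltW.
  have := ler_wpM2r (ltW BB0) zN; have := ler_wpM2r (ltW BB0) de.
  lra.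
have -> : dot z (B z) / (rnorm (B z) ^+ 2)%:C - l =
    dot (pencil l z) (B z) * ((rnorm (B z) ^+ 2)^-1)%:C.
  have [_ _ dZl _] := sesqui_dot dot.
  rewrite /pencil dotBl dZl (dot_diag norm_dot) fmorphV mulrBl mulfK //.
  by rewrite -(rmorph0 (real_complex R)) (inj_eq (@complexI R)) gt_eqF.
rewrite cmodM cmodR ?invr_ge0 ?(ltW BB0) // ler_pdivrMr //.
have := ler_wpM2r (ltW BB0) de.
have : 0 <= d * (b' ^+ 2 * rnorm (B z) ^+ 2 - 1).
  by rewrite mulr_ge0 ?subr_ge0 // ltW.
have : 0 <= d * rnorm (B z) ^+ 2 by rewrite mulr_ge0 // ltW.
lra.
Qed.

End Pencil.

(** * GMRES residuals *)

Section Residuals.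
Context {R : realType} {H : completeNormedModType R[i]}.
Implicit Types (T : {linear H -> H}) (z : H) (k : nat).

Definition minimal_residual (T : H -> H) z k y :=
  residual_space T z k y /\
  forall w, residual_space T z k w -> rnorm y <= rnorm w.

Lemma gmres_residualP (T : H -> H) z k :
  minimal_residual T z k (gmres_residual T z k) \/ gmres_residual T z k = 0.
Proof.
have [ex|nex] := pselect (exists y, minimal_residual T z k y).
  by left; exact: (xgetPex 0 ex).
by right; apply: xgetPN => y my; apply: nex; exists y.
Qed.

Lemma gmres_residual_min (T : H -> H) z k y : minimal_residual T z k y ->
  minimal_residual T z k (gmres_residual T z k).
Proof. by move=> my; apply: (xgetPex 0); exists y. Qed.

Lemma residual_space0 T z y : residual_space T z 0 y <-> y = z.
Proof.
split=> [[_ [c _ <-] <-]|->]; first by rewrite big_ord0 linear0 addr0.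
by exists 0; [exists (fun=> 0) => //; rewrite big_ord0|rewrite linear0 addr0].
Qed.

Lemma residual_space1 T z y :
  residual_space T z 1 y <-> exists c, y = z - c *: T z.
Proof.
split=> [[_ [c _ <-] <-]|[c ->]].
  by exists (- c ord0); rewrite big_ord1 /= linearZ scaleNr opprK.
exists (- (c *: z)); last by rewrite linearN linearZ.
by exists (fun=> - c) => //; rewrite big_ord1 /= scaleNr.
Qed.

Lemma residual_spaceS (T : H -> H) z k :
  residual_space T z k `<=` residual_space T z k.+1.
Proof.
move=> _ [_ [c _ <-] <-]; exists (\sum_(i < k) c i *: iter i T z) => //.
exists (fun i : 'I_k.+1 => if unlift ord_max i is Some j then c j else 0) => //.
rewrite big_ord_recr /= unlift_none scale0r addr0; apply: eq_bigr => i _.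
have -> : widen_ord (leqnSn k) i = lift ord_max i.
  by apply: ord_inj; rewrite lift_max.
by rewrite liftK.
Qed.

(** This bound makes both suprema in [reduction_factor] those of bounded
    sets. If the minimal residual does not exist, the default value 0 makes
    the ratio 0. *)
Lemma residual_ratio_le1 (T : H -> H) z k :
  rnorm (gmres_residual T z k.+1) / rnorm (gmres_residual T z k) <= 1.
Proof.
have [[rk _]|->] := gmres_residualP T z k; last first.
  by rewrite rnorm0 invr0 mulr0.
have [->|r0] := eqVneq (gmres_residual T z k) 0.
  by rewrite rnorm0 invr0 mulr0.
rewrite ler_pdivrMr ?rnorm_gt0 // mul1r.
have [[_ min]|->] := gmres_residualP T z k.+1; last by rewrite rnorm0 rnorm_ge0.
exact/min/residual_spaceS.
Qed.

Lemma residual_ratio_le_reduction_factor (T : H -> H) z k :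
  rnorm (gmres_residual T z k.+1) / rnorm (gmres_residual T z k) <=
  reduction_factor T.
Proof.
have ub1 z' : has_ubound (range (fun k : nat =>
    rnorm (gmres_residual T z' k.+1) / rnorm (gmres_residual T z' k))).
  by exists 1 => _ [j _ <-]; exact: residual_ratio_le1.
apply: (@le_trans _ _ (sup (range (fun k : nat =>
    rnorm (gmres_residual T z k.+1) / rnorm (gmres_residual T z k))))).
  by apply: ub_le_sup => //; exists k.
apply: ub_le_sup; last by exists z.
exists 1 => _ [z' _ <-]; apply: ge_sup; first by eexists; exists 0%N.
by move=> _ [j _ <-]; exact: residual_ratio_le1.
Qed.

Lemma reduction_factor_ge0 (T : H -> H) : 0 <= reduction_factor T.
Proof.
apply: le_trans (residual_ratio_le_reduction_factor T 0 0).
by rewrite divr_ge0 ?rnorm_ge0.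
Qed.

Variable dot : {dot H for Num.conj}.
Hypothesis norm_dot : forall x : H, `|x| = sqrtC (dot x x).

(** The residual spaces for k = 0 and k = 1 are the point z and the line of
    the vectors z - m T z, so the first residual is the shortest of these
    vectors and its ratio to z has a square of at least [t]. *)
Lemma first_step_le_reduction_factor T z (t : R) : z != 0 ->
  (forall m, t * rnorm z ^+ 2 <= rnorm (z - m *: T z) ^+ 2) ->
  t <= reduction_factor T ^+ 2.
Proof.
move=> z0 tz.
have r0E : gmres_residual T z 0 = z.
  have z_min : minimal_residual T z 0 z.
    by split=> [|w /residual_space0->]; [exact/residual_space0|].
  by have [/residual_space0] := gmres_residual_min z_min.
have [c cmin] := line_distance_attained norm_dot z (T z).
have r1_min : minimal_residual T z 1 (z - c *: T z).
  split=> [|w /residual_space1[m ->]]; last exact: cmin.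
  by apply/residual_space1; exists c.
have [/residual_space1[m mE] _] := gmres_residual_min r1_min.
have := residual_ratio_le_reduction_factor T z 0; rewrite r0E mE.
rewrite ler_pdivrMr ?rnorm_gt0 // => le_rf.
have Z0 : 0 < rnorm z ^+ 2 by rewrite exprn_gt0 ?rnorm_gt0.
rewrite -(ler_pM2r Z0); apply: (le_trans (tz m)); rewrite -exprMn.
by rewrite ler_pXn2r ?nnegrE ?rnorm_ge0 // mulr_ge0 ?reduction_factor_ge0 ?rnorm_ge0.
Qed.

End Residuals.

(** * The minimizers for an invertible operator *)

Section Proposition.
Context {R : realType} {H : completeNormedModType R[i]}.
Variable dot : {dot H for Num.conj}.
Hypothesis norm_dot : forall x : H, `|x| = sqrtC (dot x x).
Hypothesis H_neq0 : exists x : H, x != 0.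
Variables B Binv : {linear H -> H}.
Hypotheses (B_bounded : bounded_operator B) (Binv_bounded : bounded_operator Binv).
Hypothesis BK : cancel B Binv.

Lemma pencil_inf_attained :
  exists l, attains_inf (fun l => opnorm (fun x => x - l *: B x)) l.
Proof.
have [b b0 Bb] := bounded_pos B_bounded.
have Bx0 : exists x, B x != 0.
  have [x x0] := H_neq0; exists x; apply: contraNneq x0 => Bx0.
  by rewrite -(BK x) Bx0 linear0.
have [l lmin] := opnorm_pencil_minimizer H_neq0 b0 Bb Bx0.
exists l; apply/attains_infP => // m.
exact: (opnorm_pencil_ge0 H_neq0 Bb).
Qed.

Variable l : R[i].
Hypothesis l_attains : attains_inf (fun l => opnorm (fun x => x - l *: B x)) l.

Lemma minimizer_extremal_vector (e : R) : 0 < e -> exists z,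
  [/\ rnorm z = 1,
      forall m, opnorm (pencil B l) ^+ 2 - e <= rnorm (z - m *: B z) ^+ 2 &
      cmod (dot z (B z) / (rnorm (B z) ^+ 2)%:C - l) <= e].
Proof.
have [b b0 Bb] := bounded_pos B_bounded.
have [b' b'0 Bb'] := bounded_pos Binv_bounded.
apply: (extremal_vector H_neq0 b0 Bb norm_dot _ b'0).
  apply/attains_infP => // m; exact: (opnorm_pencil_ge0 H_neq0 Bb).
by move=> x; rewrite -{1}(BK x).
Qed.

Lemma minimizer_in_closure_num_range : closure (num_range dot Binv) l.
Proof.
move=> U /nbhs_ballP[e /= e0 eU].
have eR : e = (complex.Re e)%:C by rewrite RRe_real // gtr0_real.
have r0 : 0 < complex.Re e / 2 by rewrite divr_gt0 // -ltcR -eR.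
have [z [z1 _ zl]] := minimizer_extremal_vector r0.
have z0 : z != 0 by rewrite -rnorm_gt0 z1.
have Bz0 : B z != 0 by apply: contraNneq z0 => E; rewrite -(BK z) E linear0.
exists (dot z (B z) / (rnorm (B z) ^+ 2)%:C); split.
  exists (((rnorm (B z))^-1)%:C *: B z); first exact: normalize.
  have [_ _ dZl dZr] := sesqui_dot dot.
  rewrite [Binv _]linearZ /= BK dZl dZr mulrA mulcJ cmodR ?invr_ge0 ?rnorm_ge0 //.
  by rewrite mulrC exprVn fmorphV.
apply: eU; rewrite -ball_normE /= -normrN opprB norm_cmod eR ltcR.
by apply: (le_lt_trans zl); rewrite ltr_pdivrMr // ltr_pMr ?ltr1n // -ltcR -eR.
Qed.

Lemma opnorm_scale_le (M : R) : opnorm (pencil B l) <= M ->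
  opnorm (fun x => l *: B x) <= 1 + M.
Proof.
move=> NM; have [b b0 Bb] := bounded_pos B_bounded.
have N0 := opnorm_pencil_ge0 H_neq0 Bb l.
apply: opnorm_le => [|x]; first by rewrite addr_ge0 // (le_trans N0).
have -> : l *: B x = x - pencil B l x by rewrite /pencil opprB addrC subrK.
rewrite (le_trans (rnormD _ _)) // rnormN mulrDl mul1r lerD2l.
by apply: (le_trans (le_opnorm_pencil Bb l x)); rewrite ler_wpM2r ?rnorm_ge0.
Qed.

(** The norm of I - l B is, up to any e, already the least value of |z - m Bz|
    over all m for some unit vector z; a bound [M] on these least values
    therefore bounds the norm. *)
Lemma norm_le_of_vector_bounds (M : R) : 0 <= M ->
  (forall z (t : R), rnorm z = 1 ->
    (forall m, t <= rnorm (z - m *: B z) ^+ 2) -> t <= M ^+ 2) ->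
  opnorm (fun x => l *: B x) <= 1 + M.
Proof.
move=> M0 zM; apply: opnorm_scale_le.
have [b b0 Bb] := bounded_pos B_bounded.
rewrite -(ler_pXn2r (n := 2)) ?nnegrE ?(opnorm_pencil_ge0 H_neq0 Bb) //.
apply/ler_addgt0Pr => e e0; rewrite -lerBlDr.
have [z [z1 zm _]] := minimizer_extremal_vector e0.
exact: zM z1 zm.
Qed.

Lemma minimizer_norm_le :
  opnorm (fun x => l *: B x) <= 1 + reduction_factor B.
Proof.
apply: norm_le_of_vector_bounds => [|z t z1 zm].
  exact: reduction_factor_ge0.
apply: (first_step_le_reduction_factor norm_dot (z := z)).
  by rewrite -rnorm_gt0 z1.
by move=> m; rewrite z1 expr1n mulr1.
Qed.

(** The vector to test in [reduction_factor Binv] is Bz: its distance to the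
    line of Binv (Bz) = z is, relatively, that of z to the line of Bz. *)
Lemma minimizer_norm_le_inverse :
  opnorm (fun x => l *: B x) <= 1 + reduction_factor Binv.
Proof.
apply: norm_le_of_vector_bounds => [|z t z1 zm].
  exact: reduction_factor_ge0.
have z0 : z != 0 by rewrite -rnorm_gt0 z1.
have Bz0 : B z != 0 by apply: contraNneq z0 => E; rewrite -(BK z) E linear0.
apply: (first_step_le_reduction_factor norm_dot Bz0).
rewrite BK; apply: (line_distance_sym norm_dot z0 Bz0) => m.
by rewrite z1 expr1n mulr1.
Qed.

End Proposition.

Unset Implicit Arguments.
Local Open Scope complex_scope.

Theorem proposition3p3 (R : realType) (H : completeNormedModType R[i])
    (dot : {dot H for Num.conj})
    (norm_dot : forall x : H, `|x| = sqrtC (dot x x))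
    (H_neq0 : exists x : H, x != 0)
    (B Binv : {linear H -> H})
    (B_bounded : bounded_operator B) (B_inv : bounded_inverse B Binv) :
  [/\ exists lB : R[i], attains_inf (fun l => opnorm (fun x => x - l *: B x)) lB,
      exists lBinv : R[i], attains_inf (fun l => opnorm (fun x => x - l *: Binv x)) lBinv,
      forall lB : R[i], attains_inf (fun l => opnorm (fun x => x - l *: B x)) lB ->
        closure (num_range dot Binv) lB /\
        opnorm (fun x => lB *: B x) <= 1 + reduction_factor B
    & forall lBinv : R[i], attains_inf (fun l => opnorm (fun x => x - l *: Binv x)) lBinv ->
        closure (num_range dot B) lBinv /\
        opnorm (fun x => lBinv *: Binv x) <= 1 + reduction_factor B].
Proof.
have [BK BinvK Binv_bounded] := B_inv.
split.
- exact: pencil_inf_attained.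
- exact: (pencil_inf_attained H_neq0 Binv_bounded BinvK).
- move=> l l_min; split.
    exact: (minimizer_in_closure_num_range norm_dot H_neq0 B_bounded).
  exact: (minimizer_norm_le norm_dot H_neq0 B_bounded Binv_bounded BK).
- move=> l l_min; split.
    exact: (minimizer_in_closure_num_range norm_dot H_neq0 Binv_bounded).
  exact: (minimizer_norm_le_inverse norm_dot H_neq0 Binv_bounded B_bounded BinvK).
Qed.
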